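(* Let $X$ be a set, $I$ a nonempty finite set, and $\mathcal{F}=(f_i)_{i\in I}$, $f_i:X\to X$, a family of functions having attractor. Let $M>0$, the metric $d$ on $X$, the points $r_n\in(0,4M]$ ($n\in\mathbb{N}$), the functions $\varphi_r$ ($r\in(0,4M]$) and $\varphi=\sup_{n\in\mathbb{N}}\varphi_{r_n}$ be as described in the context. Then all the functions $f_i$, $i\in I$, are $\varphi$-contractions, i.e. $d(f_i(x),f_i(y))\le\varphi(d(x,y))$ for every $x,y\in X$ and every $i\in I$.
   Context: $\mathbb{N}=\{0,1,2,\dots\}$ and $\mathbb{N}^*=\{1,2,\dots\}$. $\Lambda(I)=I^{\mathbb{N}^*}$ is the set of infinite words with letters in $I$; $\Lambda^*(I)$ is the set of all finite words with letters in $I$, including the empty word $\lambda$; $|\alpha|$ is the length of a finite word $\alpha$. For $\alpha=\alpha_1\alpha_2\dots\in\Lambda(I)$, $[\alpha]_n=\alpha_1\dots\alpha_n$ if $n\ge 1$ and $[\alpha]_0=\lambda$. Put $f_\lambda=\mathrm{Id}_X$, $f_{\alpha_1\dots\alpha_m}=f_{\alpha_1}\circ\dots\circ f_{\alpha_m}$, and $X_\alpha=f_\alpha(X)$ for $\alpha\in\Lambda^*(I)$. Family having attractor: $(f_i)_{i\in I}$ ($I$ finite) has attractor if: (a) for every $\alpha\in\Lambda(I)$ the set $\bigcap_{n\in\mathbb{N}}X_{[\alpha]_n}$ has a unique element, denoted $a_\alpha$; (b) if $a_\alpha\ne a_\beta$, then there exists $n_0\in\mathbb{N}$ with $X_{[\alpha]_{n_0}}\cap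 X_{[\beta]_{n_0}}=\emptyset$. The attractor is $A=\{a_\alpha\mid\alpha\in\Lambda(I)\}$. For $\alpha\in\Lambda^*(I)$: $Y_\alpha=\{a_\beta\mid \beta\in\Lambda(I),\ X_\alpha\cap X_{[\beta]_n}\ne\emptyset\text{ for every }n\in\mathbb{N}\}$ and $\widetilde{X_\alpha}=X_\alpha\cup Y_\alpha$. For a sequence $\mu=(z_n)_{n\in\mathbb{N}}$ with $0<z_{n+1}\le z_n$ for all $n$, $d^\mu:X\times X\to[0,\infty)$ is defined by $d^\mu(x,y)=0$ if $x=y$, and $d^\mu(x,y)=\inf M_{x,y}$ if $x\ne y$, where $M_{x,y}$ is the set of all sums $\sum_{i=0}^p z_{|\alpha_i|}$ with $p\in\mathbb{N}$ and $\alpha_0,\dots,\alpha_p\in\Lambda^*(I)$ such that $x\in\widetilde{X_{\alpha_0}}$, $y\in\widetilde{X_{\alpha_p}}$ and $\widetilde{X_{\alpha_i}}\cap\widetilde{X_{\alpha_{i+1}}}\ne\emptyset$ for every $i\in\{0,\dots,p-1\}$. Fixed data: $M>0$; a sequence $(\mu_n)_{n\in\mathbb{N}}$ of sequences $\mu_n=(z^n_k)_{k\in\mathbb{N}}$ with $0<z^n_{k+1}\le z^n_k\le M$ for all $k,n$, $\lim_{k\to\infty}z^n_k=0$ and $d^{\mu_n}\le M$ for every $n$, and such that for all $x,y\in A$ with $x\ne y$ there exists $n$ with $d^{\mu_n}(x,y)>0$. Then $\eta=(z_k)_{k\in\mathbb{N}}$ with $z_k=\sum_{n=0}^\infty\frac{1}{2^n}z^n_k$,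 and $\delta=d^\eta$. $(c_n)_{n\in\mathbb{N}}$ is a fixed strictly increasing sequence of real numbers with $c_0=1$, $\left(\frac{c_n}{c_{n+1}}\right)_{n\in\mathbb{N}}$ strictly increasing, and $c_n\le 2$, $\frac12\le\frac{c_n}{c_{n+1}}$ for every $n$. The metric $d$ is $d(x,y)=\sup_{\alpha\in\Lambda^*(I)}c_{|\alpha|}\,\delta(f_\alpha(x),f_\alpha(y))$; it is a bounded complete metric on $X$. For every $r\in(0,4M]$, $n_r\in\mathbb{N}$ is chosen such that the $d$-diameters satisfy $\operatorname{diam}_d(X_\alpha)\le\operatorname{diam}_d(\widetilde{X_\alpha})\le\frac{r}{20}$ for every $\alpha\in\Lambda^*(I)$ with $|\alpha|\ge n_r$ (such $n_r$ exists). For $r\in(0,4M)$ choose $\rho_r\in(0,\min\{4M-r,\frac r2\})$ and define $\varphi_r:[0,\infty)\to[0,\infty)$ by $\varphi_r(x)=0$ for $x\in[0,r-\rho_r)$; $\varphi_r(x)=\frac{c_{n_r}}{c_{n_r+1}}x$ for $x\in[r-\rho_r,r+\rho_r]$; $\varphi_r(x)=\frac{c_{n_r}}{c_{n_r+1}}(r+\rho_r)$ for $x\in(r+\rho_r,\infty)$. Define $\varphi_{4M}$ by $\varphi_{4M}(x)=0$ for $x\in[0,2M)$; $\varphi_{4M}(x)=\frac{c_{n_M}}{c_{n_M+1}}x$ for $x\in[2M,4M]$; $\varphi_{4M}(x)=\frac{c_{n_M}}{c_{n_M+1}}4M$ for $x\in(4M,\infty)$. $(r_n)_{n\in\mathbb{N}}$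 is a sequence of elements of $(0,4M]$ such that $(0,4M]=\bigcup_{n\in\mathbb{N}}[r_n-\rho_{r_n},r_n+\rho_{r_n}]$ and the family of intervals $\{[r_n-\rho_{r_n},r_n+\rho_{r_n}]\}_{n\in\mathbb{N}}$ is locally finite in $(0,4M]$, where $[r_n-\rho_{r_n},r_n+\rho_{r_n}]$ means $[2M,4M]$ in case $r_n=4M$. *)

(* Defs.v *)
From HB Require Import structures.
From mathcomp Require Import all_boot all_order all_algebra.
From mathcomp Require Import all_classical all_reals all_analysis.

Set Implicit Arguments.
Unset Strict Implicit.
Unset Printing Implicit Defensive.

Import Order.TTheory GRing.Theory Num.Theory.
Import numFieldNormedType.Exports.

Local Open Scope classical_set_scope.
Local Open Scope ring_scope.

(* An infinite word alpha_1 alpha_2 ... is encoded as alpha : nat -> I whose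
   value at k is the letter alpha_(k+1); a finite word is a seq I, so that
   mkseq alpha n is the prefix [alpha]_n. *)

Section Family.
Variables (X : Type) (I : finType) (f : I -> X -> X).

(* f_(alpha_1 ... alpha_m) = f_(alpha_1) \o ... \o f_(alpha_m) *)
Definition fword (w : seq I) : X -> X := foldr (fun i g => f i \o g) id w.

Definition Xw (w : seq I) : set X := range (fword w).

(* a is the point a_alpha; it is kept as a relation since X is a bare type. *)
Definition is_point (alpha : nat -> I) (a : X) : Prop :=
  \bigcap_n Xw (mkseq alpha n) = [set a].

Definition has_attractor : Prop :=
  (forall alpha : nat -> I, exists a : X, is_point alpha a) /\
  (forall (alpha beta : nat -> I) (a b : X),
     is_point alpha a -> is_point beta b -> a <> b ->
     exists n0 : nat, Xw (mkseq alpha n0) `&` Xw (mkseq beta n0) = set0).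

Definition attractor : set X := [set a | exists alpha, is_point alpha a].

Definition Yw (w : seq I) : set X :=
  [set a | exists beta, is_point beta a /\
             forall n : nat, Xw w `&` Xw (mkseq beta n) !=set0].

Definition tildeX (w : seq I) : set X := Xw w `|` Yw w.

Variable R : realType.

Definition chain_sums (z : nat -> R) (x y : X) : set R :=
  [set s | exists (p : nat) (a : nat -> seq I),
     [/\ tildeX (a 0%N) x, tildeX (a p) y,
         (forall i, (i < p)%N -> tildeX (a i) `&` tildeX (a i.+1) !=set0)
       & s = \sum_(0 <= i < p.+1) z (size (a i))]].

Definition dmu (z : nat -> R) (x y : X) : R :=
  if `[< x = y >] then 0 else inf (chain_sums z x y).

(* Under the hypotheses of interest the set is bounded above, by 4 M. *)
Definition dmetric (c z : nat -> R) (x y : X) : R :=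
  sup [set c (size w) * dmu z (fword w x) (fword w y) | w in [set: seq I]].

End Family.

Definition eta_seq (R : realType) (z : nat -> nat -> R) (k : nat) : R :=
  limn (series (fun n => 1 / 2 ^+ n * z n k)).

Definition diam (R : realType) (X : Type) (d : X -> X -> R) (S : set X) : R :=
  sup [set d x y | x in S & y in S].

Section Comparison.
Variables (R : realType) (M : R) (c : nat -> R) (nr : R -> nat) (rho : R -> R).

(* The functions [0, oo) -> [0, oo) are total functions on R; only their
   values at nonnegative arguments are meaningful. *)
Definition phi_r (r x : R) : R :=
  if r == 4 * M then
    let q := c (nr M) / c (nr M).+1 in
    if x < 2 * M then 0 else if x <= 4 * M then q * x else q * (4 * M)
  else
    let q := c (nr r) / c (nr r).+1 in
    if x < r - rho r then 0
    else if x <= r + rho r then q * x else q * (r + rho r).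

(* [r - rho_r, r + rho_r], read as [2 M, 4 M] when r = 4 M *)
Definition itv_r (r : R) : set R :=
  if r == 4 * M then [set` `[2 * M, 4 * M]]
  else [set` `[r - rho r, r + rho r]].

Definition phi_sup (rs : nat -> R) (x : R) : R :=
  sup [set phi_r (rs n) x | n in [set: nat]].

End Comparison.

(* Local finiteness, as an indexed family, in the subspace D. *)
Definition locally_finite_in (T : topologicalType) (D : set T)
    (F : nat -> set T) : Prop :=
  forall x, D x ->
    exists2 U, nbhs x U & finite_set [set n | F n `&` (D `&` U) !=set0].

(* Main.v *)
Require Import Defs.
From HB Require Import structures.
From mathcomp Require Import all_boot all_order all_algebra.
From mathcomp Require Import all_classical all_reals all_analysis.
From mathcomp Require Import ring lra.

Set Implicit Arguments.
Unset Strict Implicit.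
Unset Printing Implicit Defensive.

Import Order.TTheory GRing.Theory Num.Theory.
Import numFieldNormedType.Exports.

Local Open Scope classical_set_scope.
Local Open Scope ring_scope.

(** Write [d] for the metric [dmetric f c (eta_seq z)] and [delta] for the
    pseudometric [dmu f (eta_seq z)] it is built from.  Two mechanisms make
    [d (f i x) (f i y)] smaller than [d x y].

    - Index shift.  The term of a word [w] in the supremum defining
      [d (f i x) (f i y)] is the term of the longer word [rcons w i] in the
      supremum defining [d x y], except that it carries the weight
      [c (size w)] instead of [c (size w).+1].  So it is at most
      [c (size w) / c (size w).+1 * d x y], and since these quotients increase
      with the length, one factor [c N / c N.+1] serves all words of length at
      most [N] ([dmetric_fi_le]).
    - Small cylinders.  For a long word [w] both points lie in [Xw f w], whose
      diameter is at most [r / 20].  When [d x y] is of order [r], this beats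
      the factor [c N / c N.+1], which is at least [1 / 2].

    Together they give [d (f i x) (f i y) <= c (nr r) / c (nr r).+1 * d x y]
    whenever [r / 2 <= d x y] ([dmetric_fi_le_scale]).  Every positive value of
    [d] lies in some interval of the cover because [d <= 4 * M]: the empty word
    alone is a chain from [x] to [y], hence [delta x y <= eta_seq z 0 <= 2 * M],
    and the weights [c] are at most [2].  On the interval attached to [r] the
    function [phi_r r] is multiplication by the factor above, taken at the
    scale [M] instead of [r] when [r = 4 * M], and [phi_r r <= id] on
    nonnegative reals makes the supremum of the [phi_r]'s finite.  If
    [d x y = 0], the index shift already forces [d (f i x) (f i y) = 0]. *)

(** * Suprema of dominated families *)

(** [sup] is only meaningful on sets bounded above; the bound [B] provides the
    boundedness. *)
Lemma le_sup_bounded (R : realType) (S : set R) (B a : R) :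
  ubound S B -> S a -> a <= sup S.
Proof. by move=> SB Sa; apply: ub_le_sup => //; exists B. Qed.

(** * The pseudometric of a sequence of weights *)

Section Weights.
Variables (R : realType) (X : Type) (I : finType) (f : I -> X -> X).

Lemma fword_rcons w i x : fword f (rcons w i) x = fword f w (f i x).
Proof. by elim: w => //= j w ->. Qed.

(** The empty word, whose cylinder is all of [X], is a chain of length one
    between any two points. *)
Lemma chain_sums_nil (z : nat -> R) x y : chain_sums f z x y (z 0%N).
Proof.
exists 0%N, (fun=> [::]); split=> //; last by rewrite big_nat1.
- by left; exists x.
- by left; exists y.
Qed.

Variables (z : nat -> R) (z_ge0 : forall k, 0 <= z k).

Lemma chain_sums_ge0 x y : lbound (chain_sums f z x y) 0.
Proof. by move=> _ [p [a [_ _ _ ->]]]; apply: sumr_ge0. Qed.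

Lemma dmu_ge0 x y : 0 <= dmu f z x y.
Proof.
rewrite /dmu; case: ifP => // _; apply: lb_le_inf; last exact: chain_sums_ge0.
by exists (z 0%N); exact: chain_sums_nil.
Qed.

Lemma dmu_le0th x y : dmu f z x y <= z 0%N.
Proof.
rewrite /dmu; case: ifP => // _; apply: ge_inf; last exact: chain_sums_nil.
by exists 0; exact: chain_sums_ge0.
Qed.

(** * The weighted supremum over words *)

Variables (c : nat -> R) (C B : R).
Hypotheses (c_gt0 : forall n, 0 < c n) (c_le : forall n, c n <= C).
Hypothesis z_le : z 0%N <= B.

Let d := dmetric f c z.

Let term_le w x y : c (size w) * dmu f z (fword f w x) (fword f w y) <= C * B.
Proof.
apply: ler_pM; rewrite ?dmu_ge0 ?c_le //; first exact: ltW.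
exact: le_trans (dmu_le0th _ _) z_le.
Qed.

Lemma le_dmetric w x y :
  c (size w) * dmu f z (fword f w x) (fword f w y) <= d x y.
Proof.
by apply: (@le_sup_bounded _ _ (C * B)); [move=> _ [v _ <-] | exists w].
Qed.

Lemma dmetric_le_of_terms x y b :
  (forall w, c (size w) * dmu f z (fword f w x) (fword f w y) <= b) ->
  d x y <= b.
Proof.
move=> le_b; apply: ge_sup; last by move=> _ [w _ <-].
by exists (c 0%N * dmu f z x y), [::].
Qed.

Lemma dmetric_le x y : d x y <= C * B.
Proof. exact/dmetric_le_of_terms. Qed.

Lemma dmetric_ge0 x y : 0 <= d x y.
Proof.
apply: le_trans (le_dmetric [::] x y).
by rewrite mulr_ge0 ?dmu_ge0 // ltW.
Qed.

Lemma dmetric_le_diam (S : set X) x y : S x -> S y -> d x y <= diam d S.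
Proof.
move=> Sx Sy; apply: (@le_sup_bounded _ _ (C * B)); last by exists x; last exists y.
by move=> _ [u _ [v _ <-]]; exact: dmetric_le.
Qed.

(** The long words of the supremum are left as a hypothesis: the index shift
    alone gives no uniform factor below [1], as [c n / c n.+1] may tend to
    [1]. *)
Lemma dmetric_fi_le (N : nat) i x y :
  (forall m, (m <= N)%N -> c m / c m.+1 <= c N / c N.+1) ->
  (forall w, (N <= size w)%N ->
     c (size w) * dmu f z (fword f w (f i x)) (fword f w (f i y))
       <= c N / c N.+1 * d x y) ->
  d (f i x) (f i y) <= c N / c N.+1 * d x y.
Proof.
move=> c_incr long; apply: dmetric_le_of_terms => w.
have [/long//|/ltnW short] := leqP N (size w).
have := le_dmetric (rcons w i) x y; rewrite !fword_rcons size_rcons.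
set t := dmu _ _ _ _ => le_d.
have -> : c (size w) * t = c (size w) / c (size w).+1 * (c (size w).+1 * t).
  by rewrite mulrA divfK // gt_eqF.
apply: ler_pM => //; last exact: c_incr.
  by rewrite divr_ge0 // ltW.
by rewrite mulr_ge0 ?dmu_ge0 // ltW.
Qed.

(** A word as long as [N] sends both points into a cylinder of diameter at
    most [r / 20], which the weight at most [2] turns into [r / 10]; the right
    hand side is at least [1 / 2 * (r / 2)]. *)
Lemma dmetric_fi_le_scale (N : nat) (r : R) i x y :
  c 0%N = 1 -> C = 2 ->
  (forall m, (m <= N)%N -> c m / c m.+1 <= c N / c N.+1) ->
  1 / 2 <= c N / c N.+1 ->
  (forall w, (N <= size w)%N -> diam d (Xw f w) <= r / 20) ->
  0 < r -> r / 2 <= d x y ->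
  d (f i x) (f i y) <= c N / c N.+1 * d x y.
Proof.
move=> c0 C2 c_incr half small r0 rd; apply: dmetric_fi_le => // w Nw.
have le_diam : d (fword f w (f i x)) (fword f w (f i y)) <= r / 20.
  apply: le_trans (small w Nw).
  by apply: dmetric_le_diam; [exists (f i x) | exists (f i y)].
have := le_dmetric [::] (fword f w (f i x)) (fword f w (f i y)).
rewrite /= c0 mul1r => dmu_le_d.
have : c (size w) * dmu f z (fword f w (f i x)) (fword f w (f i y)) <= 2 * (r / 20).
  apply: ler_pM; rewrite ?dmu_ge0 //; first exact: ltW.
    by rewrite -C2.
  exact: le_trans le_diam.
have : 1 / 2 * (r / 2) <= c N / c N.+1 * d x y.
  by apply: ler_pM => //; lra.
lra.
Qed.

End Weights.

(** * The averaged weights *)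

Section Average.
Variables (R : realType) (M : R) (z : nat -> nat -> R) (k : nat).
Hypotheses (z_ge0 : forall n, 0 <= z n k) (z_le : forall n, z n k <= M).

Let u n : R := 1 / 2 ^+ n * z n k.

Let u_ge0 n : 0 <= u n.
Proof. by rewrite mulr_ge0 // divr_ge0 // exprn_ge0. Qed.

(* The geometric sum with its remainder, so that the induction closes. *)
Let partial_le N : series u N <= M * (2 - 2 / 2 ^+ N).
Proof.
rewrite /series /=; elim: N => [|N IH].
  by rewrite big_nil expr0 divr1 subrr mulr0.
rewrite big_nat_recr //=.
have h : 1 / 2 ^+ N * z N k <= 1 / 2 ^+ N * M.
  by rewrite ler_wpM2l // divr_ge0 // exprn_ge0.
have -> : M * (2 - 2 / 2 ^+ N.+1) = M * (2 - 2 / 2 ^+ N) + 1 / 2 ^+ N * M.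
  by rewrite exprS; field; rewrite expf_neq0.
exact: lerD.
Qed.

Let partial_le2M N : series u N <= 2 * M.
Proof.
apply: le_trans (partial_le N) _.
have M0 : 0 <= M by exact: le_trans (z_ge0 0%N) (z_le 0%N).
by rewrite mulrC ler_wpM2r // gerBl divr_ge0 // exprn_ge0.
Qed.

Let series_cvg : cvgn (series u).
Proof.
apply: nondecreasing_is_cvgn; last by exists (2 * M) => _ [N _ <-].
by apply: nondecreasing_series => n _ _; exact: u_ge0.
Qed.

Lemma eta_seq_ge0 : 0 <= eta_seq z k.
Proof.
apply: limr_ge; first exact: series_cvg.
by apply: nearW => N; apply: sumr_ge0 => n _; exact: u_ge0.
Qed.

Lemma eta_seq_le : eta_seq z k <= 2 * M.
Proof.
apply: limr_le; first exact: series_cvg.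
by apply: nearW => N; exact: partial_le2M.
Qed.

End Average.

(** * The comparison functions *)

Section Comparison.
Variables (R : realType) (M : R) (c : nat -> R) (nr : R -> nat) (rho : R -> R).
Hypothesis M_gt0 : 0 < M.
Hypotheses (q_ge0 : forall n, 0 <= c n / c n.+1).
Hypotheses (q_le1 : forall n, c n / c n.+1 <= 1).

(** The hypothesis on [rho] is what keeps the plateau value beyond the interval
    nonnegative. *)
Lemma phi_r_ge0_le (r t : R) :
  (0 < r < 4 * M -> 0 < rho r) -> 0 < r <= 4 * M -> 0 <= t ->
  0 <= phi_r M c nr rho r t <= t.
Proof.
move=> rho_gt0 /andP[r0 rM] t0; rewrite /phi_r.
have q_mul n (s : R) : 0 <= s -> s <= t -> 0 <= c n / c n.+1 * s <= t.
  move=> s0 st; rewrite mulr_ge0 //=; apply: le_trans st.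
  by rewrite -[leRHS]mul1r ler_wpM2r.
case: eqVneq => [_|r4].
  case: ifP => _; first by rewrite lexx.
  case: (leP t (4 * M)) => [_|/ltW lt]; first exact: q_mul.
  by apply: q_mul => //; rewrite mulr_ge0 // ltW.
have {rho_gt0}rho0 : 0 < rho r by apply: rho_gt0; rewrite r0 lt_neqAle r4.
case: ifP => _; first by rewrite lexx.
case: (leP t (r + rho r)) => [_|/ltW lt]; first exact: q_mul.
by apply: q_mul => //; rewrite addr_ge0 // ltW.
Qed.

Lemma phi_r_on_itv (r t : R) : itv_r M rho r t ->
  phi_r M c nr rho r t
    = (let N := nr (if r == 4 * M then M else r) in c N / c N.+1) * t.
Proof.
rewrite /itv_r /phi_r; case: ifP => _ /=; rewrite in_itv /= => /andP[l ->];
  by rewrite ltNge l.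
Qed.

Variables (rs : nat -> R).
Hypothesis rho_gt0 : forall r, 0 < r < 4 * M -> 0 < rho r.
Hypothesis rs_in : forall n, 0 < rs n <= 4 * M.

Lemma phi_r_le_phi_sup n t : 0 <= t ->
  phi_r M c nr rho (rs n) t <= phi_sup M c nr rho rs t.
Proof.
move=> t0; apply: (@le_sup_bounded _ _ t); last by exists n.
by move=> _ [m _ <-]; have /andP[] := phi_r_ge0_le (@rho_gt0 _) (rs_in m) t0.
Qed.

Lemma phi_sup_ge0 t : 0 <= t -> 0 <= phi_sup M c nr rho rs t.
Proof.
move=> t0; apply: le_trans (phi_r_le_phi_sup 0 t0).
by have /andP[] := phi_r_ge0_le (@rho_gt0 _) (rs_in 0) t0.
Qed.

End Comparison.

Theorem lemma3p20 (R : realType) (X : Type) (I : finType) (f : I -> X -> X)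
  (hI : (0 < #|I|)%N)
  (hf : has_attractor f)
  (M : R) (hM : 0 < M)
  (z : nat -> nat -> R)
  (hz : forall n k, [/\ 0 < z n k.+1, z n k.+1 <= z n k & z n k <= M])
  (hz0 : forall n, z n @ \oo --> (0 : R))
  (hzM : forall n x y, dmu f (z n) x y <= M)
  (hzA : forall x y, attractor f x -> attractor f y -> x <> y ->
           exists n, 0 < dmu f (z n) x y)
  (c : nat -> R)
  (hc0 : c 0%N = 1)
  (hc : forall m n, (m < n)%N -> c m < c n)
  (hcq : forall m n, (m < n)%N -> c m / c m.+1 < c n / c n.+1)
  (hc2 : forall n, c n <= 2)
  (hcq2 : forall n, 1 / 2 <= c n / c n.+1)
  (nr : R -> nat)
  (hnr : forall r : R, 0 < r <= 4 * M -> forall w : seq I, (nr r <= size w)%N ->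
           diam (dmetric f c (eta_seq z)) (Xw f w)
             <= diam (dmetric f c (eta_seq z)) (tildeX f w) <= r / 20)
  (rho : R -> R)
  (hrho : forall r : R, 0 < r < 4 * M -> 0 < rho r < Num.min (4 * M - r) (r / 2))
  (rs : nat -> R)
  (hrs : forall n, 0 < rs n <= 4 * M)
  (hcover : [set` `]0, 4 * M]] = \bigcup_n itv_r M rho (rs n))
  (hlf : locally_finite_in [set` `]0, 4 * M]]
           (fun n => itv_r M rho (rs n))) :
  forall (i : I) (x y : X),
    dmetric f c (eta_seq z) (f i x) (f i y)
      <= phi_sup M c nr rho rs (dmetric f c (eta_seq z) x y).
Proof.
have c_gt0 n : 0 < c n.
  by case: n => [|n]; [rewrite hc0 | rewrite (lt_trans ltr01) // -hc0 hc].
have q_ge0 n : 0 <= c n / c n.+1 by rewrite divr_ge0 // ltW.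
have q_le1 n : c n / c n.+1 <= 1 by rewrite ler_pdivrMr // mul1r ltW // hc.
have q_incr m n : (m <= n)%N -> c m / c m.+1 <= c n / c n.+1.
  by rewrite leq_eqVlt => /predU1P[->//|/hcq/ltW].
have z_ge0 n k : 0 <= z n k.
  by have [h1 h2 _] := hz n k; apply/ltW/(lt_le_trans h1).
have z_le n k : z n k <= M by have [] := hz n k.
have eta_ge0 k : 0 <= eta_seq z k by exact: (@eta_seq_ge0 _ M).
have eta_le : eta_seq z 0 <= 2 * M by exact: eta_seq_le.
have rho_gt0 (r : R) : 0 < r < 4 * M -> 0 < rho r by move=> /hrho /andP[].
move=> i x y; set d := dmetric f c (eta_seq z).
have d_ge0 : 0 <= d x y by exact: (dmetric_ge0 f eta_ge0 c_gt0 hc2 eta_le).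
have scale (r : R) : 0 < r <= 4 * M -> r / 2 <= d x y ->
    d (f i x) (f i y) <= c (nr r) / c (nr r).+1 * d x y.
  move=> r_in; have /andP[r0 _] := r_in.
  apply: (dmetric_fi_le_scale eta_ge0 c_gt0 hc2 eta_le) => //.
  - by move=> m; exact: q_incr.
  - by move=> w /(hnr _ r_in)/andP[h]; exact: le_trans.
have [d0|d_neq0] := eqVneq (d x y) 0.
  (* Only the index shift is available here: every word has factor at most 1. *)
  apply: le_trans (phi_sup_ge0 nr hM q_ge0 q_le1 rho_gt0 hrs d_ge0).
  apply: dmetric_le_of_terms => w.
  have := le_dmetric f eta_ge0 c_gt0 hc2 eta_le (rcons w i) x y.
  rewrite -/d d0 !fword_rcons size_rcons; apply: le_trans.
  by rewrite ler_wpM2r ?dmu_ge0 // ltW // hc.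
have d_in : `]0, 4 * M]%classic (d x y).
  rewrite /= in_itv /= lt_neqAle eq_sym d_neq0 d_ge0 /=.
  have := dmetric_le f eta_ge0 c_gt0 hc2 eta_le x y.
  by rewrite -/d; lra.
move: d_in; rewrite hcover => -[n _ d_n].
apply: le_trans (phi_r_le_phi_sup nr hM q_ge0 q_le1 rho_gt0 hrs n d_ge0).
rewrite (phi_r_on_itv _ _ d_n) /=; apply: scale.
  by case: ifP => _ //; rewrite hM /=; lra.
(* At [rs n = 4 * M] the factor is that of scale [M], and [M / 2 <= 2 * M]; for
   the other intervals [rho r < r / 2] bounds the left endpoint below. *)
have /andP[r0 rM] := hrs n.
move: d_n; rewrite /itv_r; case: eqVneq => [_|r4]; rewrite /= in_itv /= => /andP[l _].
  by lra.
have /hrho /andP[_] : 0 < rs n < 4 * M by rewrite r0 lt_neqAle r4.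
by rewrite lt_min => /andP[_]; lra.
Qed.
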